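(* Let $A\in\mathbb{S}_1$, $D\in\mathbb{S}_2$, $E\in\mathbb{S}_3$ and $L\in\mathbb{R}^{k\times l}$. Suppose that $w=[x^\top,y^\top,z^\top]^\top$ is the unique solution of the double saddle point problem $\mathfrak{B}w=b$ and take $\tau=\gamma=2$. Then the structured partial condition number of $w$ with respect to $L$ is $$\mathfrak{K}^{(2),\mathbb{S}}_{\varphi}(\mathbf{H},b;L)=\left\|\Theta_{\xi_L^\ddagger}L\mathfrak{B}^{-1}\begin{bmatrix}\mathcal{G}&-I_l\end{bmatrix}\begin{bmatrix}\Theta_{\mathrm{vec}(\Psi)}\Phi_{\mathbb{S}}\mathfrak{D}_{\mathbb{S}}^{-1} & 0 \\ 0 & \Theta_\chi\end{bmatrix}\right\|_2,$$ where $$\Phi_{\mathbb{S}}=\begin{bmatrix}\Phi_{\mathbb{S}_1} & 0 & 0 & 0 \\ 0 & I_{mn+mp} & 0 & 0 \\ 0 & 0 & \Phi_{\mathbb{S}_2} & 0 \\ 0 & 0 & 0 & \Phi_{\mathbb{S}_3}\end{bmatrix},\qquad \mathfrak{D}_{\mathbb{S}}=\begin{bmatrix}\Theta_{u_1} & 0 & 0 & 0 \\ 0 & I_{mn+mp} & 0 & 0 \\ 0 & 0 & \Theta_{u_2} & 0 \\ 0 & 0 & 0 & \Theta_{u_3}\end{bmatrix},$$ $u_1=[\|\Phi_{\mathbb{S}_1}(:,1)\|_2,\dots,\|\Phi_{\mathbb{S}_1}(:,s)\|_2]^\top$, $u_2=[\|\Phi_{\mathbb{S}_2}(:,1)\|_2,\dots,\|\Phi_{\mathbb{S}_2}(:,r)\|_2]^\top$,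 $u_3=[\|\Phi_{\mathbb{S}_3}(:,1)\|_2,\dots,\|\Phi_{\mathbb{S}_3}(:,q)\|_2]^\top$, and $\Phi(:,j)$ denotes the $j$-th column of $\Phi$.
   Context: Let $A\in\mathbb{R}^{n\times n}$, $B\in\mathbb{R}^{m\times n}$, $C\in\mathbb{R}^{p\times m}$, $D\in\mathbb{R}^{m\times m}$, $E\in\mathbb{R}^{p\times p}$, $l=n+m+p$, $b\in\mathbb{R}^{l}$, and $$\mathfrak{B}=\begin{bmatrix} A & B^\top & 0 \\ B & -D & C^\top \\ 0 & C & E \end{bmatrix},$$ which is assumed nonsingular throughout. The double saddle point problem (DSPP) is $\mathfrak{B}w=b$ with $w=[x^\top,y^\top,z^\top]^\top$, $x\in\mathbb R^n$, $y\in\mathbb R^m$, $z\in\mathbb R^p$. Notation: $\mathrm{vec}$ stacks the columns of a matrix; for a tuple of matrices $\mathrm{vec}(X_1,\dots,X_r)=[\mathrm{vec}(X_1)^\top,\dots,\mathrm{vec}(X_r)^\top]^\top$. $\otimes$ is the Kronecker product and $\odot$ the entrywise product (componentwise on tuples). $\Theta_v$ is the diagonal matrix with diagonal $v$. For a vector or matrix $v$, $v^\ddagger$ has entries $1/v_i$ if $v_i\ne0$ and $1$ if $v_i=0$. Write $\mathbf{H}=(A,B,C,D,E)$ and $$\mathcal{G}=\begin{bmatrix} x^\top\otimes I_n & I_n\otimes y^\top & 0 & 0 & 0 \\ 0 & x^\top\otimes I_m & I_m\otimes z^\top & -y^\top\otimes I_m & 0 \\ 0 & 0 & y^\top\otimes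 I_p & 0 & z^\top\otimes I_p \end{bmatrix}.$$ Linear structures: $\mathbb{S}_1\subseteq\mathbb{R}^{n\times n}$, $\mathbb{S}_2\subseteq\mathbb{R}^{m\times m}$, $\mathbb{S}_3\subseteq\mathbb{R}^{p\times p}$ are linear subspaces of structured matrices (such as symmetric or Toeplitz) of dimensions $s,r,q$. For each there is a fixed structure matrix $\Phi_{\mathbb{S}_1}\in\mathbb{R}^{n^2\times s}$, $\Phi_{\mathbb{S}_2}\in\mathbb{R}^{m^2\times r}$, $\Phi_{\mathbb{S}_3}\in\mathbb{R}^{p^2\times q}$ such that every $X\in\mathbb{S}_i$ has a unique generating vector $g$ with $\mathrm{vec}(X)=\Phi_{\mathbb{S}_i}g$. These structure matrices have mutually orthogonal columns and at most one nonzero entry in each row, and are such that whenever $\Psi_X,\Delta X\in\mathbb{S}_i$ have generating vectors $\psi,\delta$ and entries of $\Delta X$ vanish wherever those of $\Psi_X$ vanish, $\mathrm{vec}(\Psi_X^\ddagger\odot\Delta X)=\Phi_{\mathbb{S}_i}(\psi^\ddagger\odot\delta)$. For $L\in\mathbb{R}^{k\times l}$ ($k\le l$) put $\varphi(\mathbf{H},b)=L\mathfrak{B}^{-1}b$. Let $\xi_L\in\mathbb{R}^k$, $\chi\in\mathbb{R}^l$ and $\Psi=(\Psi_A,\Psi_B,\Psi_C,\Psi_D,\Psi_E)$ with $\Psi_A\in\mathbb{S}_1$, $\Psi_B\in\mathbb{R}^{m\times n}$, $\Psi_C\in\mathbb{R}^{p\times m}$, $\Psi_D\in\mathbb{S}_2$,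 $\Psi_E\in\mathbb{S}_3$ be parameters. For $\tau=\gamma=2$ the structured partial condition number is $$\mathfrak{K}^{(2),\mathbb{S}}_{\varphi}(\mathbf{H},b;L)=\lim_{\epsilon\to0}\ \sup_{\substack{0<\|\mathrm{vec}(\Psi^\ddagger\odot\Delta\mathbf{H},\,\chi^\ddagger\odot\Delta b)\|_2\le\epsilon\\ \Delta A\in\mathbb{S}_1,\ \Delta D\in\mathbb{S}_2,\ \Delta E\in\mathbb{S}_3}}\frac{\|\xi_L^\ddagger\odot(\varphi(\mathbf{H}+\Delta\mathbf{H},b+\Delta b)-\varphi(\mathbf{H},b))\|_2}{\|\mathrm{vec}(\Psi^\ddagger\odot\Delta\mathbf{H},\,\chi^\ddagger\odot\Delta b)\|_2},$$ where $\Delta\mathbf{H}=(\Delta A,\Delta B,\Delta C,\Delta D,\Delta E)$ and $\Delta b$ also have zero entries wherever the corresponding entry of $\Psi$, respectively $\chi$, is zero. *)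

(* Defs.v *)
From HB Require Import structures.
From mathcomp Require Export all_boot all_order all_algebra.
From mathcomp Require Export mxtens.
From mathcomp Require Export all_classical all_reals all_analysis.
Export Order.TTheory GRing.Theory Num.Theory.
Export numFieldNormedType.Exports.

Set Implicit Arguments.
Unset Strict Implicit.
Unset Printing Implicit Defensive.

Local Open Scope classical_set_scope.
Local Open Scope ring_scope.

(* [mxvec] is row-major, so stacking the columns of X amounts to reading its
   transpose row by row. *)
Definition vec (R : realType) (m n : nat) (X : 'M[R]_(m, n)) : 'cV[R]_(n * m) :=
  (mxvec X^T)^T.

Definition norm2 (R : realType) (k : nat) (v : 'cV[R]_k) : R :=
  Num.sqrt (\sum_i v i 0 ^+ 2).

(* The operator norm of M induced by the Euclidean norms. *)
Definition mxnorm2 (R : realType) (k l : nat) (M : 'M[R]_(k, l)) : R :=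
  sup [set norm2 (M *m v) | v in [set v : 'cV[R]_l | norm2 v <= 1]].

Definition Theta (R : realType) (k : nat) (v : 'cV[R]_k) : 'M[R]_k :=
  diag_mx v^T.

Definition ddag (R : realType) (k l : nat) (M : 'M[R]_(k, l)) : 'M[R]_(k, l) :=
  map_mx (fun a => if a == 0 then 1 else a^-1) M.

Definition odot (R : realType) (k l : nat) (M N : 'M[R]_(k, l)) :
  'M[R]_(k, l) := map2_mx *%R M N.

Record dspp (R : realType) (n m p : nat) := Dspp {
  blkA : 'M[R]_n;
  blkB : 'M[R]_(m, n);
  blkC : 'M[R]_(p, m);
  blkD : 'M[R]_m;
  blkE : 'M[R]_p }.

Section Tuple.
Variables (R : realType) (n m p : nat).
Implicit Types (H G : dspp R n m p).

Definition addH H G : dspp R n m p :=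
  Dspp (blkA H + blkA G) (blkB H + blkB G) (blkC H + blkC G)
       (blkD H + blkD G) (blkE H + blkE G).

Definition odotH H G : dspp R n m p :=
  Dspp (odot (blkA H) (blkA G)) (odot (blkB H) (blkB G))
       (odot (blkC H) (blkC G)) (odot (blkD H) (blkD G))
       (odot (blkE H) (blkE G)).

Definition ddagH H : dspp R n m p :=
  Dspp (ddag (blkA H)) (ddag (blkB H)) (ddag (blkC H))
       (ddag (blkD H)) (ddag (blkE H)).

(* The bracketing A, ((B, C), (D, E)) leaves the blocks of B and C adjacent, as
   needed to meet the identity block of order mn + mp in [PhiS]. *)
Definition vecH H :
    'cV[R]_(n * n + ((n * m + m * p) + (m * m + p * p))) :=
  col_mx (vec (blkA H))
    (col_mx (col_mx (vec (blkB H)) (vec (blkC H)))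
            (col_mx (vec (blkD H)) (vec (blkE H)))).

Definition saddle_mx H : 'M[R]_(n + m + p) :=
  block_mx (block_mx (blkA H) (blkB H)^T (blkB H) (- blkD H))
           (col_mx 0 (blkC H)^T)
           (row_mx 0 (blkC H)) (blkE H).

(* [invmx] returns its argument on singular matrices; in the limit defining the
   condition number only arguments close to nonsingular ones matter. *)
Definition phi (k : nat) (L : 'M[R]_(k, n + m + p)) H (b : 'cV[R]_(n + m + p)) :
  'cV[R]_k := L *m invmx (saddle_mx H) *m b.

End Tuple.

(* x^T (x) I_k and I_k (x) y^T; the casts identify 1 * k and k * 1 with k. *)
Definition kron_trl (R : realType) (j k : nat) (x : 'cV[R]_j) :
  'M[R]_(k, j * k) :=
  castmx (mul1n k, erefl) (tensmx x^T (1%:M : 'M[R]_k)).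

Definition kron_trr (R : realType) (j k : nat) (y : 'cV[R]_j) :
  'M[R]_(k, k * j) :=
  castmx (muln1 k, erefl) (tensmx (1%:M : 'M[R]_k) y^T).

Definition calG (R : realType) (n m p : nat)
    (x : 'cV[R]_n) (y : 'cV[R]_m) (z : 'cV[R]_p) :
    'M[R]_(n + m + p, n * n + ((n * m + m * p) + (m * m + p * p))) :=
  col_mx
   (col_mx
     (row_mx (kron_trl n x)
       (row_mx (row_mx (kron_trr n y) 0)            (row_mx 0 0)))
     (row_mx 0
       (row_mx (row_mx (kron_trl m x) (kron_trr m z))
               (row_mx (- kron_trl m y) 0))))
   (row_mx 0
       (row_mx (row_mx 0 (kron_trl p y))            (row_mx 0 (kron_trl p z)))).

Record structure_mx (R : realType) (k s : nat) (S : {vspace 'M[R]_k})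
    (Phi : 'M[R]_(k * k, s)) : Prop := StructureMx {
  structure_dim : \dim S = s;
  structure_gen : forall X : 'M[R]_k, X \in S ->
    exists! g : 'cV[R]_s, vec X = Phi *m g;
  structure_orth : forall i j : 'I_s, i != j ->
    (col i Phi)^T *m col j Phi = 0;
  structure_row : forall (i : 'I_(k * k)) (j j' : 'I_s),
    Phi i j != 0 -> Phi i j' != 0 -> j = j';
  structure_ddag : forall (PsiX DX : 'M[R]_k) (psi delta : 'cV[R]_s),
    PsiX \in S -> DX \in S ->
    vec PsiX = Phi *m psi -> vec DX = Phi *m delta ->
    (forall i j, PsiX i j = 0 -> DX i j = 0) ->
    vec (odot (ddag PsiX) DX) = Phi *m odot (ddag psi) delta }.

Section ConditionNumber.
Variables (R : realType) (n m p k : nat).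
Variables (S1 : {vspace 'M[R]_n}) (S2 : {vspace 'M[R]_m})
          (S3 : {vspace 'M[R]_p}).
Variables (L : 'M[R]_(k, n + m + p)) (xiL : 'cV[R]_k).
Variables (Psi : dspp R n m p) (chi : 'cV[R]_(n + m + p)).
Variables (H : dspp R n m p) (b : 'cV[R]_(n + m + p)).

Definition pert_norm (dH : dspp R n m p) (db : 'cV[R]_(n + m + p)) : R :=
  norm2 (col_mx (vecH (odotH (ddagH Psi) dH)) (odot (ddag chi) db)).

Definition admissible (dH : dspp R n m p) (db : 'cV[R]_(n + m + p)) : Prop :=
  [/\ blkA dH \in S1, blkD dH \in S2, blkE dH \in S3,
      forall i, vecH Psi i 0 = 0 -> vecH dH i 0 = 0 &
      forall i, chi i 0 = 0 -> db i 0 = 0].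

Definition error_ratio (dH : dspp R n m p) (db : 'cV[R]_(n + m + p)) : R :=
  norm2 (odot (ddag xiL) (phi L (addH H dH) (b + db) - phi L H b))
  / pert_norm dH db.

(* Supremum in [0, +oo]: the maximum with 0 only makes the supremum of the empty
   set equal to 0, which occurs when no nonzero perturbation is admissible (for
   instance when Psi and chi vanish). *)
Definition sup_ratio (eps : R) : \bar R :=
  maxe 0%E (ereal_sup
    [set r : \bar R | exists (dH : dspp R n m p) (db : 'cV[R]_(n + m + p)),
       [/\ admissible dH db, 0 < pert_norm dH db <= eps &
           r = (error_ratio dH db)%:E]]).

Definition cond_number : \bar R := lim (sup_ratio eps @[eps --> 0^'+]).

Lemma sup_ratio_is_cvg : cvg (sup_ratio eps @[eps --> 0^'+]).
Proof.
apply: nondecreasing_at_right_is_cvge; near=> e => u v _ _ uv.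
rewrite /sup_ratio ge_max le_max lexx /= le_max; apply/orP; right.
apply: ereal_sup_le => _ [dH [db [adm /andP[h0 h1] ->]]].
by exists dH, db; split=> //; rewrite h0 (le_trans h1).
Unshelve. all: by end_near. Qed.

End ConditionNumber.

Section StructureBlocks.
Variables (R : realType) (n m p s r q : nat).
Variables (Phi1 : 'M[R]_(n * n, s)) (Phi2 : 'M[R]_(m * m, r))
          (Phi3 : 'M[R]_(p * p, q)).

Definition PhiS : 'M[R]_(n * n + ((n * m + m * p) + (m * m + p * p)),
                         s + ((n * m + m * p) + (r + q))) :=
  block_mx Phi1 0 0 (block_mx 1%:M 0 0 (block_mx Phi2 0 0 Phi3)).

Definition col_norms (a t : nat) (Phi : 'M[R]_(a, t)) : 'cV[R]_t :=
  \col_j norm2 (col j Phi).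

Definition DS : 'M[R]_(s + ((n * m + m * p) + (r + q))) :=
  block_mx (Theta (col_norms Phi1)) 0 0
    (block_mx 1%:M 0 0
       (block_mx (Theta (col_norms Phi2)) 0 0 (Theta (col_norms Phi3)))).

End StructureBlocks.

(* Main.v *)
From HB Require Import structures.
Require Import Defs.
From mathcomp Require Import ring lra.

(** Three observations reduce the condition number to an operator norm.

    Structure. Applying the rule for weighted perturbations to the generators of
    the structure shows that a structure matrix is a 0/1 matrix whose columns are
    indicators of disjoint nonempty sets of rows ([structure_indicator]), so it
    commutes with entrywise operations on generating vectors and becomes an
    isometry once its columns are normalized ([norm2_indicator]). The block
    matrix P made of the structure matrices and identities is of the same kind.
    Let M be the last factor of the formula: weights, times P, times the inverse
    of the diagonal matrix of column norms. Each admissible perturbation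
    D = (dH, db) is M v for some v with |v| equal to the weighted norm of D
    ([admissible_lift]), and each M v is admissible with weighted norm at most
    |v| ([admissible_realize]).

    Linearization. Since calG (vec dH) = dB w for the perturbation dB of the saddle
    matrix ([calG_vecH]), the solution changes by - B^-1 [G, -I] D up to a
    remainder that is quadratic in D ([phi_first_order]).

    Limit. With F = Theta L B^-1 [G, -I], the quotient for D = M v, where |v| is the
    weighted norm of D, thus differs from |F M v| / |v| by at most C |v|. Hence
    its supremum over perturbations of size at most e lies between the operator
    norm of F M minus C e and the same norm plus C e, and the limit follows by
    squeezing ([lim_at0_linear_bounds]). The lower bound uses that a vector v of
    the unit ball gives the admissible perturbation M (e v), whose weighted norm
    is at most e: the quotient is then at least |F M v| up to the remainder. *)

Set Implicit Arguments.
Unset Strict Implicit.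
Unset Printing Implicit Defensive.

Local Open Scope classical_set_scope.
Local Open Scope ring_scope.

(** * Euclidean, Frobenius and operator norms *)

(** The square of the Frobenius norm. It makes sense for every block shape and
    turns concatenation of blocks into addition; on columns it is the square of
    the Euclidean norm, and its square root dominates the operator norm. *)
Definition sqnormF (R : realType) (a t : nat) (M : 'M[R]_(a, t)) : R :=
  \sum_i \sum_j M i j ^+ 2.

Section Norm.
Variable R : realType.
Implicit Types a t : nat.

Lemma sqnormF_ge0 a t (M : 'M[R]_(a, t)) : 0 <= sqnormF M.
Proof. by apply: sumr_ge0 => i _; apply: sumr_ge0 => j _; apply: sqr_ge0. Qed.

Lemma norm2E a (v : 'cV[R]_a) : norm2 v = Num.sqrt (sqnormF v).
Proof. by congr Num.sqrt; apply: eq_bigr => i _; rewrite big_ord1. Qed.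

Lemma norm2_ge0 a (v : 'cV[R]_a) : 0 <= norm2 v.
Proof. exact: sqrtr_ge0. Qed.

Lemma sqr_norm2 a (v : 'cV[R]_a) : norm2 v ^+ 2 = \sum_i v i 0 ^+ 2.
Proof. by rewrite sqr_sqrtr // sumr_ge0 // => i _; apply: sqr_ge0. Qed.

Lemma sqr_norm2F a (v : 'cV[R]_a) : norm2 v ^+ 2 = sqnormF v.
Proof. by rewrite norm2E sqr_sqrtr ?sqnormF_ge0. Qed.

Lemma sqnormF_col_mx a1 a2 t (M : 'M[R]_(a1, t)) (N : 'M[R]_(a2, t)) :
  sqnormF (col_mx M N) = sqnormF M + sqnormF N.
Proof.
rewrite /sqnormF big_split_ord /=; congr (_ + _); apply: eq_bigr => i _;
  by apply: eq_bigr => j _; rewrite ?col_mxEu ?col_mxEd.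
Qed.

Lemma sqnormF_trmx a t (M : 'M[R]_(a, t)) : sqnormF M^T = sqnormF M.
Proof.
rewrite /sqnormF exchange_big.
by apply: eq_bigr => i _; apply: eq_bigr => j _; rewrite mxE.
Qed.

Lemma sqnormF_row_mx a t1 t2 (M : 'M[R]_(a, t1)) (N : 'M[R]_(a, t2)) :
  sqnormF (row_mx M N) = sqnormF M + sqnormF N.
Proof. by rewrite -sqnormF_trmx tr_row_mx sqnormF_col_mx !sqnormF_trmx. Qed.

Lemma sqnormFN a t (M : 'M[R]_(a, t)) : sqnormF (- M) = sqnormF M.
Proof.
by apply: eq_bigr => i _; apply: eq_bigr => j _; rewrite mxE sqrrN.
Qed.

Lemma sqnormF0 a t : sqnormF (0 : 'M[R]_(a, t)) = 0.
Proof. by apply: big1 => i _; apply: big1 => j _; rewrite mxE expr0n. Qed.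

Lemma sum_sqr_eq0 t (f : 'I_t -> R) i : \sum_j f j ^+ 2 = 0 -> f i = 0.
Proof.
move/eqP; rewrite psumr_eq0 => [/allP/(_ i)|j _]; last exact: sqr_ge0.
by rewrite mem_index_enum sqrf_eq0 => /(_ isT)/eqP.
Qed.

Lemma norm2_eq0 a (v : 'cV[R]_a) : norm2 v = 0 -> v = 0.
Proof.
move=> v0; apply/colP => i; rewrite mxE (sum_sqr_eq0 (f := v^~ 0)) //.
by rewrite -sqr_norm2 v0 expr0n.
Qed.

Lemma norm2_0 a : norm2 (0 : 'cV[R]_a) = 0.
Proof. by rewrite norm2E sqnormF0 sqrtr0. Qed.

Lemma norm2Z a c (v : 'cV[R]_a) : norm2 (c *: v) = `|c| * norm2 v.
Proof.
rewrite -sqrtr_sqr -sqrtrM ?sqr_ge0 // mulr_sumr; congr Num.sqrt.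
by apply: eq_bigr => i _; rewrite mxE exprMn.
Qed.

Lemma norm2N a (v : 'cV[R]_a) : norm2 (- v) = norm2 v.
Proof. by rewrite !norm2E sqnormFN. Qed.

Lemma ler_norm2 a (u v : 'cV[R]_a) :
  (forall i, `|u i 0| <= `|v i 0|) -> norm2 u <= norm2 v.
Proof.
move=> le_uv; apply: ler_wsqrtr; apply: ler_sum => i _.
rewrite -[leLHS]real_normK ?num_real // -[leRHS]real_normK ?num_real //.
by rewrite lerXn2r ?nnegrE.
Qed.

Lemma norm2_le_sqr a (v : 'cV[R]_a) c :
  0 <= c -> norm2 v ^+ 2 <= c ^+ 2 -> norm2 v <= c.
Proof. by move=> c0; rewrite ler_pXn2r // nnegrE norm2_ge0. Qed.

(** Expanding the nonnegative sum of the squares of f i * B - g i * S, with B the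
    sum of the g i ^+ 2 and S that of the f i * g i, gives B times the claim. *)
Lemma cauchy_schwarz t (f g : 'I_t -> R) :
  (\sum_i f i * g i) ^+ 2 <= (\sum_i f i ^+ 2) * (\sum_i g i ^+ 2).
Proof.
set S := \sum_i f i * g i; set A := \sum_i f i ^+ 2; set B := \sum_i g i ^+ 2.
have B_ge0 : 0 <= B by apply: sumr_ge0 => i _; apply: sqr_ge0.
have : 0 <= \sum_i (f i * B - g i * S) ^+ 2.
  by apply: sumr_ge0 => i _; apply: sqr_ge0.
have -> : \sum_i (f i * B - g i * S) ^+ 2 = B * (A * B - S ^+ 2).
  transitivity (A * B ^+ 2 - S * (2 * B * S) + B * S ^+ 2); last by ring.
  rewrite !mulr_suml -sumrB -big_split /=.
  by apply: eq_bigr => i _; ring.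
have [B0 _|B_neq0] := eqVneq B 0; last first.
  by rewrite pmulr_rge0 ?subr_ge0 // lt_def B_neq0.
rewrite B0 mulr0 /S big1 ?expr0n // => i _.
by rewrite (sum_sqr_eq0 i B0) mulr0.
Qed.

Lemma norm2_mulmx a t (M : 'M[R]_(a, t)) (v : 'cV[R]_t) :
  norm2 (M *m v) <= Num.sqrt (sqnormF M) * norm2 v.
Proof.
apply: norm2_le_sqr; first by rewrite mulr_ge0 ?sqrtr_ge0.
rewrite exprMn !sqr_norm2 sqr_sqrtr ?sqnormF_ge0 // mulr_suml.
by apply: ler_sum => i _; rewrite mxE cauchy_schwarz.
Qed.

Lemma norm2D a (u v : 'cV[R]_a) : norm2 (u + v) <= norm2 u + norm2 v.
Proof.
apply: norm2_le_sqr; first by rewrite addr_ge0 ?norm2_ge0.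
have le_uv : \sum_i u i 0 * v i 0 <= norm2 u * norm2 v.
  apply: le_trans (ler_norm _) _.
  rewrite -ler_sqr ?nnegrE ?mulr_ge0 ?norm2_ge0 //.
  by rewrite real_normK ?num_real // exprMn !sqr_norm2 cauchy_schwarz.
have -> : norm2 (u + v) ^+ 2 =
    norm2 u ^+ 2 + 2 * (\sum_i u i 0 * v i 0) + norm2 v ^+ 2.
  rewrite !sqr_norm2 mulr_sumr -!big_split /=.
  by apply: eq_bigr => i _; rewrite mxE; ring.
by lra.
Qed.

Lemma norm2B a (u v : 'cV[R]_a) : `|norm2 u - norm2 v| <= norm2 (u - v).
Proof.
have := norm2D (u - v) v; have := norm2D (v - u) u.
rewrite !subrK -[v - u]opprB norm2N ler_norml => h1 h2.
by apply/andP; split; lra.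
Qed.

Lemma has_sup_mxnorm2 a t (M : 'M[R]_(a, t)) :
  has_sup [set norm2 (M *m v) | v in [set v | norm2 v <= 1]].
Proof.
split; first by exists (norm2 (M *m 0)), 0 => //=; rewrite norm2_0.
exists (Num.sqrt (sqnormF M)) => _ [u /= u1 <-].
by rewrite (le_trans (norm2_mulmx _ _)) // ler_piMr ?sqrtr_ge0.
Qed.

Lemma mxnorm2_ge0 a t (M : 'M[R]_(a, t)) : 0 <= mxnorm2 M.
Proof.
apply: (sup_upper_bound (has_sup_mxnorm2 M)).
by exists 0; rewrite ?mulmx0 /= norm2_0.
Qed.

Lemma mxnorm2_ge a t (M : 'M[R]_(a, t)) v :
  norm2 (M *m v) <= mxnorm2 M * norm2 v.
Proof.
have [v0|v_neq0] := eqVneq (norm2 v) 0.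
  by rewrite v0 (norm2_eq0 v0) mulmx0 norm2_0 mulr0.
have v_gt0 : 0 < norm2 v by rewrite lt_def v_neq0 norm2_ge0.
rewrite -ler_pdivrMr //; apply: (sup_upper_bound (has_sup_mxnorm2 M)).
exists ((norm2 v)^-1 *: v) => /=; last first.
  by rewrite -scalemxAr norm2Z ger0_norm ?invr_ge0 ?norm2_ge0 // mulrC.
by rewrite norm2Z ger0_norm ?invr_ge0 ?norm2_ge0 // mulVf.
Qed.

Lemma mxnorm2_le a t (M : 'M[R]_(a, t)) c :
  (forall v, norm2 v <= 1 -> norm2 (M *m v) <= c) -> mxnorm2 M <= c.
Proof.
move=> leMc; apply: ge_sup => [|_ [v v1 <-]]; last exact: leMc.
by exists (norm2 (M *m 0)), 0 => //=; rewrite norm2_0.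
Qed.

End Norm.

(** * Vectorization and Kronecker products *)

Lemma index_allpairs (T1 T2 : eqType) (s1 : seq T1) (s2 : seq T2) x1 x2 :
  x1 \in s1 -> x2 \in s2 ->
  index (x1, x2) [seq (a, b) | a <- s1, b <- s2] =
  (index x1 s1 * size s2 + index x2 s2)%N.
Proof.
move=> + s2x2; elim: s1 => //= a s1 IH.
rewrite inE index_cat; have [-> _|neq_ax1 /= s1x1] := eqVneq x1 a.
  rewrite mem_map ?s2x2 => [|? ? [] //].
  by rewrite mul0n index_map // => ? ? [].
rewrite ifF; last by apply/mapP => -[b _ [/eqP]]; rewrite (negPf neq_ax1).
by rewrite IH // size_map mulSn addnA.
Qed.

(** The definitions mix two row-major enumerations of pairs of indices: the one
    of [mxvec], which goes through the enumeration of a product type, and the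
    arithmetic one of [tensmx]. They agree, which is what lets Kronecker
    products act on vectorized matrices. *)
Lemma mxvec_index_tens (m n : nat) (i : 'I_m) (j : 'I_n) :
  mxvec_index i j = mxtens_index (i, j).
Proof.
apply: val_inj; rewrite /= /enum_rank enum_rank_in.unlock insubdK; last first.
  by rewrite cardE [_ \in _]index_mem mem_enum.
rewrite enumT unlock /= /prod_enum.
rewrite index_allpairs ?mem_enum //.
by rewrite !index_enum_ord size_enum_ord.
Qed.

Lemma vecE (R : realType) (m n : nat) (X : 'M[R]_(m, n)) i j :
  vec X (mxtens_index (j, i)) 0 = X i j.
Proof. by rewrite -mxvec_index_tens mxE mxvecE mxE. Qed.

Lemma sum_mxtens_index (R : realType) (m n : nat) (F : 'I_(m * n) -> R) :
  \sum_c F c = \sum_i \sum_j F (mxtens_index (i, j)).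
Proof.
rewrite pair_big (reindex (@mxtens_index m n)) /=; last first.
  exists (@mxtens_unindex m n) => c _.
    exact: mxtens_indexK.
  exact: mxtens_unindexK.
by apply: eq_bigr => -[].
Qed.

Lemma kron_trlE (R : realType) (j k : nat) (x : 'cV[R]_j) a i b :
  kron_trl k x a (mxtens_index (i, b)) = x i 0 * (a == b)%:R.
Proof.
rewrite castmxE !mxE cast_ord_id mxtens_indexK /= ord1; congr (_ * (_ == _)%:R).
by apply: val_inj => /=; rewrite modn_small.
Qed.

Lemma kron_trrE (R : realType) (j k : nat) (y : 'cV[R]_j) a i b :
  kron_trr k y a (mxtens_index (i, b)) = (a == i)%:R * y b 0.
Proof.
rewrite castmxE !mxE cast_ord_id mxtens_indexK /=.
congr ((_ == _)%:R * _); last by rewrite ord1.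
by apply: val_inj => /=; rewrite divn1.
Qed.

Lemma kron_trl_vec (R : realType) (j k : nat) (x : 'cV[R]_j) (X : 'M[R]_(k, j)) :
  kron_trl k x *m vec X = X *m x.
Proof.
apply/colP => a; rewrite !mxE sum_mxtens_index; apply: eq_bigr => i _.
rewrite (bigD1 a) //= big1 ?addr0 => [|b neq_ba].
  by rewrite kron_trlE vecE eqxx mulr1 mulrC.
by rewrite kron_trlE eq_sym (negPf neq_ba) mulr0 mul0r.
Qed.

Lemma kron_trr_vec (R : realType) (j k : nat) (y : 'cV[R]_j) (X : 'M[R]_(j, k)) :
  kron_trr k y *m vec X = X^T *m y.
Proof.
apply/colP => a; rewrite !mxE sum_mxtens_index (bigD1 a) //= [X in _ + X]big1.
  rewrite addr0; apply: eq_bigr => i _.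
  by rewrite kron_trrE vecE mxE eqxx mul1r mulrC.
move=> b neq_ba; apply: big1 => i _.
by rewrite kron_trrE eq_sym (negPf neq_ba) !mul0r.
Qed.

(** The two sides read the same bilinear expression in opposite ways: the left
    one as linear in the blocks, the right one as linear in the solution. *)
Lemma calG_vecH (R : realType) (n m p : nat) (x : 'cV[R]_n) (y : 'cV[R]_m)
    (z : 'cV[R]_p) (G : dspp R n m p) :
  calG x y z *m vecH G = saddle_mx G *m col_mx (col_mx x y) z.
Proof.
rewrite /calG /vecH /saddle_mx !mul_col_mx !mul_row_col !mul_block_col.
rewrite !mul_col_mx !mul0mx !mulNmx.
rewrite !(kron_trl_vec, kron_trr_vec) !(add0r, addr0).
by rewrite add_col_mx addr0 addrAC.
Qed.

Section VecTheory.
Variable R : realType.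
Implicit Types a t : nat.

HB.instance Definition _ a t :=
  GRing.Linear.copy (@vec R a t) (trmx \o mxvec \o trmx).

Lemma vec_odot a t (M N : 'M[R]_(a, t)) : vec (odot M N) = odot (vec M) (vec N).
Proof.
apply/colP => c; case: (mxtens_indexP c) => j i.
by rewrite vecE [LHS]mxE [RHS]mxE !vecE.
Qed.

Lemma vec_ddag a t (M : 'M[R]_(a, t)) : vec (ddag M) = ddag (vec M).
Proof.
apply/colP => c; case: (mxtens_indexP c) => j i.
by rewrite vecE [LHS]mxE [RHS]mxE !vecE.
Qed.

Lemma odot_col_mx a1 a2 t (M1 N1 : 'M[R]_(a1, t)) (M2 N2 : 'M[R]_(a2, t)) :
  odot (col_mx M1 M2) (col_mx N1 N2) = col_mx (odot M1 N1) (odot M2 N2).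
Proof. exact: map2_col_mx. Qed.

Lemma ddag_col_mx a1 a2 t (M : 'M[R]_(a1, t)) (N : 'M[R]_(a2, t)) :
  ddag (col_mx M N) = col_mx (ddag M) (ddag N).
Proof. exact: map_col_mx. Qed.

Lemma odot_Theta a (u v : 'cV[R]_a) : odot u v = Theta u *m v.
Proof. by apply/colP => i; rewrite /Theta mul_diag_mx !mxE. Qed.

Lemma Theta_col_mx a1 a2 (u : 'cV[R]_a1) (v : 'cV[R]_a2) :
  Theta (col_mx u v) = block_mx (Theta u) 0 0 (Theta v).
Proof. by rewrite /Theta tr_col_mx diag_mx_row. Qed.

Definition unvec a t (v : 'cV[R]_(t * a)) : 'M[R]_(a, t) := (vec_mx v^T)^T.

HB.instance Definition _ a t :=
  GRing.Linear.copy (@unvec a t) (trmx \o vec_mx \o trmx).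

Lemma unvecK a t : cancel (@unvec a t) (@vec R a t).
Proof. by move=> v; rewrite /vec /unvec !trmxK vec_mxK trmxK. Qed.

Lemma vecK a t : cancel (@vec R a t) (@unvec a t).
Proof. by move=> X; rewrite /vec /unvec trmxK mxvecK trmxK. Qed.

Lemma sqnormF_vec a t (X : 'M[R]_(a, t)) : sqnormF (vec X) = sqnormF X.
Proof.
rewrite -[RHS]sqnormF_trmx {1}/sqnormF sum_mxtens_index.
by apply: eq_bigr => j _; apply: eq_bigr => i _; rewrite big_ord1 vecE mxE.
Qed.

End VecTheory.

(** * First-order perturbation of the solution *)

Section Perturbation.
Variables (R : realType) (n m p : nat).
Implicit Types G : dspp R n m p.

Lemma vecH_odot_ddag G1 G2 :
  vecH (odotH (ddagH G1) G2) = odot (ddag (vecH G1)) (vecH G2).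
Proof.
by rewrite /vecH !vec_odot !vec_ddag /= !ddag_col_mx !odot_col_mx.
Qed.

Lemma saddle_mx_addH G1 G2 :
  saddle_mx (addH G1 G2) = saddle_mx G1 + saddle_mx G2.
Proof.
rewrite /saddle_mx /= !add_block_mx !add_col_mx !add_row_mx.
by rewrite !addr0 !linearD.
Qed.

(** The blocks B and C occur twice in the saddle matrix, whence the factor 2. *)
Lemma sqnormF_saddle_mx G : sqnormF (saddle_mx G) <= 2 * sqnormF (vecH G).
Proof.
rewrite /saddle_mx /vecH /block_mx.
rewrite !(sqnormF_col_mx, sqnormF_row_mx, sqnormF_vec).
rewrite !(sqnormF_col_mx, sqnormF_trmx, sqnormF0, sqnormFN).
have := sqnormF_ge0 (blkA G); have := sqnormF_ge0 (blkD G).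
have := sqnormF_ge0 (blkE G); lra.
Qed.

Lemma norm2_saddle_mx G e :
  norm2 (saddle_mx G *m e) <= 2 * norm2 (vecH G) * norm2 e.
Proof.
apply: le_trans (norm2_mulmx _ _) _; rewrite ler_wpM2r ?norm2_ge0 //.
rewrite -[leRHS]ger0_norm ?mulr_ge0 ?norm2_ge0 // -sqrtr_sqr ler_wsqrtr //.
rewrite exprMn sqr_norm2F; apply: le_trans (sqnormF_saddle_mx G) _.
by rewrite ler_wpM2r ?sqnormF_ge0 //; lra.
Qed.

Lemma unitmx_ker0 a (M : 'M[R]_a) :
  (forall v : 'cV_a, M *m v = 0 -> v = 0) -> M \in unitmx.
Proof.
move=> ker0; rewrite -unitmx_tr unitmxE unitfE; apply/det0P => -[v v_neq0].
move/(congr1 trmx); rewrite trmx_mul trmxK trmx0 => /ker0 v0.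
by move/eqP: v_neq0; apply; rewrite -[v]trmxK v0 trmx0.
Qed.

(** Write e for the change of the solution w and N for the row block [G, -I], so
    that N D = dB w - db for a perturbation D = (dH, db) of the data. Subtracting
    B w = b from the perturbed system gives B e = - N D - dB e. Hence
    e + B^-1 N D = - B^-1 dB e: for small D this makes e at most twice as long
    as B^-1 N D, so the right-hand side, which involves both dB and e, is
    quadratic in D. Only estimates on vectors occur; the inverse of the perturbed
    matrix is never expanded. *)
Lemma phi_first_order k (L : 'M[R]_(k, n + m + p)) (H : dspp R n m p) b
    (x : 'cV[R]_n) (y : 'cV[R]_m) (z : 'cV[R]_p) :
  saddle_mx H \in unitmx -> saddle_mx H *m col_mx (col_mx x y) z = b ->
  exists c d : R, [/\ 0 <= c, 0 < d & forall dH db,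
    let D := col_mx (vecH dH) db in norm2 D <= d ->
    norm2 (phi L (addH H dH) (b + db) - phi L H b +
           L *m invmx (saddle_mx H) *m row_mx (calG x y z) (- 1%:M) *m D)
      <= c * norm2 D ^+ 2].
Proof.
set B := saddle_mx H; set w := col_mx _ z; set N := row_mx _ _ => unitB Bw.
pose nrm a t (M : 'M[R]_(a, t)) := Num.sqrt (sqnormF M).
have nrm_ge0 a t (M : 'M[R]_(a, t)) : 0 <= nrm a t M by apply: sqrtr_ge0.
set Y := invmx B.
have Y_ge0 := nrm_ge0 _ _ Y.
(* With this radius, 2 |B^-1| |D| <= 1/2; the 1 keeps it finite if B^-1 = 0. *)
have d_gt0 : 0 < (4 * nrm _ _ Y + 1)^-1 by rewrite invr_gt0; lra.
exists (4 * nrm _ _ L * nrm _ _ Y ^+ 2 * nrm _ _ N), (4 * nrm _ _ Y + 1)^-1.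
split=> //; first by rewrite !mulr_ge0 ?sqr_ge0.
move=> dH db D le_Dd; set dB := saddle_mx dH.
have dBe e : norm2 (dB *m e) <= 2 * norm2 D * norm2 e.
  apply: le_trans (norm2_saddle_mx _ _) _; rewrite ler_wpM2r ?norm2_ge0 //.
  rewrite ler_wpM2l // !norm2E ler_wsqrtr // [leRHS]sqnormF_col_mx lerDl.
  exact: sqnormF_ge0.
have YdBe e : norm2 (Y *m (dB *m e)) <= 2 * nrm _ _ Y * norm2 D * norm2 e.
  apply: le_trans (norm2_mulmx _ _) _.
  have -> : 2 * nrm _ _ Y * norm2 D * norm2 e =
            nrm _ _ Y * (2 * norm2 D * norm2 e) by ring.
  by rewrite ler_wpM2l.
have half : 2 * nrm _ _ Y * norm2 D <= 1 / 2.
  have : (4 * nrm _ _ Y + 1) * norm2 D <= 1.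
    by rewrite -ler_pdivlMl ?mulr1 // -invr_gt0.
  have := norm2_ge0 D; lra.
have YdB_half e : norm2 (Y *m (dB *m e)) <= 1 / 2 * norm2 e.
  by apply: le_trans (YdBe e) _; rewrite ler_wpM2r ?norm2_ge0.
(* [phi] uses the true inverse only when the perturbed matrix is invertible: on
   its kernel v = - B^-1 dB v has at most half the length of v. *)
have unitBdB : B + dB \in unitmx.
  apply: unitmx_ker0 => v; rewrite mulmxDl => /eqP; rewrite addr_eq0 => /eqP Bv.
  apply: norm2_eq0; have := YdB_half v.
  rewrite -[dB *m v]opprK -Bv mulmxN norm2N mulKmx //.
  have := norm2_ge0 v; lra.
set e := invmx (B + dB) *m (b + db) - w.
have ND : N *m D = dB *m w - db by rewrite mul_row_col calG_vecH mulNmx mul1mx.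
have eE : e + Y *m (N *m D) = - (Y *m (dB *m e)).
  have : B *m e + dB *m e = - (N *m D).
    rewrite -mulmxDl mulmxBr mulKVmx // mulmxDl Bw ND opprB.
    by rewrite opprD addrACA subrr add0r.
  clearbody e; move/eqP; rewrite -subr_eq0 opprK => /eqP /(congr1 (mulmx Y)).
  rewrite mulmx0 !mulmxDr mulKmx // addrAC => /eqP.
  by rewrite addr_eq0 => /eqP.
have e_le : norm2 e <= 2 * (nrm _ _ Y * (nrm _ _ N * norm2 D)).
  have : norm2 (Y *m (N *m D)) <= nrm _ _ Y * (nrm _ _ N * norm2 D).
    by apply: le_trans (norm2_mulmx _ _) _; rewrite ler_wpM2l ?norm2_mulmx.
  have := norm2D (- (Y *m (dB *m e))) (- (Y *m (N *m D))).
  rewrite -eE addrK eE !norm2N; have := YdB_half e; lra.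
have -> : phi L (addH H dH) (b + db) - phi L H b + L *m Y *m N *m D =
    L *m (- (Y *m (dB *m e))).
  have Yb : Y *m b = w by rewrite -Bw mulKmx.
  by rewrite -eE /phi saddle_mx_addH -!mulmxA Yb -mulmxBr -mulmxDr.
apply: le_trans (norm2_mulmx _ _) _; rewrite norm2N.
have := ler_wpM2l (nrm_ge0 _ _ L) (YdBe e).
have := ler_wpM2l (mulr_ge0 (nrm_ge0 _ _ L) (mulr_ge0 Y_ge0 (norm2_ge0 D))) e_le.
rewrite -/(nrm _ _ L); lra.
Qed.

End Perturbation.

(** * Structure matrices *)

(** The columns of such a P are the indicators of disjoint nonempty sets of rows,
    so multiplication by P copies each coordinate of a generating vector to all
    the rows of its set, puts 0 in the remaining rows, and thereby commutes with
    entrywise products. *)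
Record indicator_mx (R : realType) a t (P : 'M[R]_(a, t)) : Prop :=
  IndicatorMx {
    indicator_idem : forall i j, P i j * P i j = P i j;
    indicator_row : forall i j j', P i j != 0 -> P i j' != 0 -> j = j';
    indicator_col : forall j, exists i, P i j != 0 }.

Section Indicator.
Variables (R : realType) (a t : nat) (P : 'M[R]_(a, t)).
Hypothesis P_ind : indicator_mx P.

Lemma indicator_eval i :
  (forall g : 'cV_t, (P *m g) i 0 = 0) \/
  exists j, forall g : 'cV_t, (P *m g) i 0 = g j 0.
Proof.
have [/existsP[j Pij]|/existsPn P0] := boolP [exists j, P i j != 0].
  right; exists j => g; rewrite mxE (bigD1 j) //= big1 ?addr0 => [|j' neq_j'j].
    have /eqP := indicator_idem P_ind i j.
    rewrite -subr_eq0 -{3}[P i j]mulr1 -mulrBr mulf_eq0 (negPf Pij) subr_eq0.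
    by move=> /eqP ->; rewrite mul1r.
  have [->|Pij'] := eqVneq (P i j') 0; first by rewrite mul0r.
  by rewrite (indicator_row P_ind Pij' Pij) eqxx in neq_j'j.
left=> g; rewrite mxE big1 // => j _.
by have := P0 j; rewrite negbK => /eqP ->; rewrite mul0r.
Qed.

Lemma odot_indicator (g h : 'cV_t) : odot (P *m g) (P *m h) = P *m odot g h.
Proof.
apply/colP => i; rewrite [LHS]mxE.
by have [P0|[j Pj]] := indicator_eval i; rewrite ?P0 ?mulr0 // !Pj mxE.
Qed.

Lemma ddag_odot_indicator (g h : 'cV_t) :
  odot (ddag (P *m g)) (P *m h) = P *m odot (ddag g) h.
Proof.
apply/colP => i; rewrite [LHS]mxE [X in X * _]mxE.
by have [P0|[j Pj]] := indicator_eval i; rewrite ?P0 ?mulr0 // !Pj !mxE.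
Qed.

(** The columns have disjoint supports, so they are orthogonal. *)
Lemma norm2_indicator (h : 'cV_t) :
  norm2 (P *m h) = norm2 (Theta (col_norms P) *m h).
Proof.
congr Num.sqrt; transitivity (\sum_i \sum_j P i j ^+ 2 * h j 0 ^+ 2).
  apply: eq_bigr => i _.
  transitivity ((P *m odot h h) i 0).
    rewrite -odot_indicator [RHS]mxE; exact: expr2.
  rewrite mxE; apply: eq_bigr => j _.
  by rewrite [P i j ^+ 2](indicator_idem P_ind) mxE.
rewrite exchange_big; apply: eq_bigr => j _ /=.
rewrite /Theta mul_diag_mx !mxE exprMn sqr_norm2 -mulr_suml; congr (_ * _).
by apply: eq_bigr => i _; rewrite mxE.
Qed.

Lemma unitmx_col_norms : Theta (col_norms P) \in unitmx.
Proof.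
rewrite unitmxE det_diag unitfE; apply/prodf_neq0 => j _.
rewrite !mxE; have [i] := indicator_col P_ind j; apply: contra_neq => /norm2_eq0.
by move/colP/(_ i); rewrite !mxE.
Qed.

Variable psi : 'cV[R]_t.
Let W := Theta (P *m psi) *m P *m invmx (Theta (col_norms P)).

Lemma weighted_mul (h : 'cV_t) :
  W *m (Theta (col_norms P) *m h) = odot (P *m psi) (P *m h).
Proof. by rewrite odot_Theta /W mulmxA mulmxKV ?unitmx_col_norms // mulmxA. Qed.

(** A perturbation P g that respects the zeros of the weights P psi is the image of
    a vector whose length is exactly the weighted length of P g. The witness is
    the generating vector of the weighted perturbation, scaled by the norms of
    the columns. *)
Lemma weighted_lift (g : 'cV_t) :
  (forall i, (P *m psi) i 0 = 0 -> (P *m g) i 0 = 0) ->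
  exists2 v, W *m v = P *m g &
    norm2 v = norm2 (odot (ddag (P *m psi)) (P *m g)).
Proof.
move=> supp; exists (Theta (col_norms P) *m odot (ddag psi) g); last first.
  by rewrite -norm2_indicator -ddag_odot_indicator.
rewrite weighted_mul -ddag_odot_indicator; apply/colP => i.
rewrite [LHS]mxE [X in _ * X]mxE mulrA [ddag _ i 0]mxE; move: (supp i).
case: eqP => [-> ->//|/eqP psi_neq0 _]; first by rewrite mulr0.
by rewrite divff ?mul1r.
Qed.

(** Conversely, the image of any v is a structured perturbation respecting the
    zeros of the weights. Its weighted length can drop below that of v since the
    coordinates of v at the zeros of psi are lost. *)
Lemma weighted_proj v :
  [/\ exists g, W *m v = P *m g,
      forall i, (P *m psi) i 0 = 0 -> (W *m v) i 0 = 0 &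
      norm2 (odot (ddag (P *m psi)) (W *m v)) <= norm2 v].
Proof.
pose h := invmx (Theta (col_norms P)) *m v.
have vE : v = Theta (col_norms P) *m h by rewrite mulKVmx ?unitmx_col_norms.
rewrite {1 2 3}vE weighted_mul; split.
- by exists (odot psi h); rewrite odot_indicator.
- by move=> i psi0; rewrite mxE psi0 mul0r.
rewrite vE -norm2_indicator; apply: ler_norm2 => i; rewrite !mxE mulrA.
case: eqP => [->|/eqP psi_neq0]; first by rewrite mulr0 mul0r normr0.
by rewrite mulVf ?mul1r.
Qed.

End Indicator.

Lemma indicator_1 (R : realType) a : indicator_mx (1%:M : 'M[R]_a).
Proof.
split=> [i j|i j j'|j]; first by rewrite !mxE -natrM; case: eqP.
- by rewrite !mxE !pnatr_eq0 !eqb0 !negbK => /eqP <- /eqP.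
by exists j; rewrite mxE eqxx oner_neq0.
Qed.

Lemma indicator_block (R : realType) a1 a2 t1 t2 (P : 'M[R]_(a1, t1))
    (Q : 'M[R]_(a2, t2)) :
  indicator_mx P -> indicator_mx Q -> indicator_mx (block_mx P 0 0 Q).
Proof.
move=> [Pi Pr Pc] [Qi Qr Qc]; split=> [i j|i j j'|j].
- by case: (split_ordP i) => i' ->; case: (split_ordP j) => j' ->;
    rewrite ?(block_mxEul, block_mxEur, block_mxEdl, block_mxEdr) ?mxE ?mulr0.
- by case: (split_ordP i) => i' ->; case: (split_ordP j) => j1 ->;
    case: (split_ordP j') => j2 ->;
    rewrite ?(block_mxEul, block_mxEur, block_mxEdl, block_mxEdr) ?mxE ?eqxx //;
    [move=> /Pr/[apply] -> | move=> /Qr/[apply] ->].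
case: (split_ordP j) => j' ->.
  by have [i Pij] := Pc j'; exists (lshift _ i); rewrite block_mxEul.
by have [i Qij] := Qc j'; exists (rshift _ i); rewrite block_mxEdr.
Qed.

Lemma col_norms_block (R : realType) a1 a2 t1 t2 (P : 'M[R]_(a1, t1))
    (Q : 'M[R]_(a2, t2)) :
  col_norms (block_mx P 0 0 Q) = col_mx (col_norms P) (col_norms Q).
Proof.
apply/colP => j; case: (split_ordP j) => j' ->;
  rewrite ?col_mxEu ?col_mxEd !mxE !norm2E block_mxEv.
  by rewrite col_col_mx !colKl sqnormF_col_mx col0 sqnormF0 addr0.
by rewrite col_col_mx !colKr sqnormF_col_mx col0 sqnormF0 add0r.
Qed.

Lemma Theta_col_norms_block (R : realType) a1 a2 t1 t2 (P : 'M[R]_(a1, t1))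
    (Q : 'M[R]_(a2, t2)) :
  Theta (col_norms (block_mx P 0 0 Q)) =
  block_mx (Theta (col_norms P)) 0 0 (Theta (col_norms Q)).
Proof. by rewrite col_norms_block Theta_col_mx. Qed.

Lemma Theta_col_norms_1 (R : realType) a :
  Theta (col_norms (1%:M : 'M[R]_a)) = 1%:M.
Proof.
rewrite -diag_const_mx; congr diag_mx; apply/rowP => j.
rewrite !mxE /norm2 (bigD1 j) //= big1 => [|i neq_ij].
  by rewrite !mxE eqxx expr1n addr0 sqrtr1.
by rewrite !mxE (negPf neq_ij) expr0n.
Qed.

Section Structure.
Variables (R : realType) (k s : nat) (S : {vspace 'M[R]_k}).
Variable Phi : 'M[R]_(k * k, s).
Hypothesis PhiP : structure_mx S Phi.

(** Generating vectors embed S into the range of Phi, whose dimension is at most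
    s = dim S; hence the two spaces coincide, and every vector generates a
    structured matrix. *)
Lemma structure_memP X : (X \in S) <-> exists g, vec X = Phi *m g.
Proof.
split=> [/(structure_gen PhiP)[g [gP _]]|]; first by exists g.
pose f := linfun ((@unvec R k k) \o mulmx Phi : 'cV[R]_s -> 'M[R]_k).
have fE g : f g = unvec (Phi *m g) by rewrite lfunE.
have -> : S = limg f.
  apply/eqP; rewrite eqEdim; apply/andP; split.
    apply/subvP => Y /(structure_gen PhiP)[g [Yg _]]; apply/memv_imgP.
    by exists g; rewrite ?memvf // fE -Yg vecK.
  have <- : \dim {:'cV[R]_s} = \dim S.
    by rewrite (structure_dim PhiP) dimvf /dim /= muln1.
  by rewrite -(limg_ker_dim f) leq_addl.
by case=> g Xg; apply/memv_imgP; exists g; rewrite ?memvf // fE -Xg vecK.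
Qed.

(** The rule for weighted perturbations, applied with both matrices equal to the
    one generated by the j-th basis vector, says that every nonzero entry a of
    column j satisfies a^-1 * a = a, so a = 1. Uniqueness of the generating vector
    of the zero matrix excludes zero columns. *)
Lemma structure_indicator : indicator_mx Phi.
Proof.
split=> [i j|i j j'|j]; last 1 first.
- apply/existsP; apply: contraT => /existsPn P0.
  have [g [_ g_uniq]] := structure_gen PhiP (mem0v S).
  have : delta_mx j 0 = 0 :> 'cV[R]_s.
    rewrite -(g_uniq (delta_mx j 0)); last first.
      rewrite -colE linear0; apply/esym/colP => i; rewrite !mxE.
      exact/eqP/negPn/P0.
    by apply: g_uniq; rewrite mulmx0 linear0.
  by move/colP/(_ j)/eqP; rewrite !mxE !eqxx oner_eq0.
- have vecX : vec (unvec (col j Phi)) = Phi *m delta_mx j 0.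
    by rewrite unvecK colE.
  have XS : unvec (col j Phi) \in S.
    by apply/structure_memP; exists (delta_mx j 0).
  have := structure_ddag PhiP XS XS vecX vecX (fun _ _ => id).
  rewrite vec_odot vec_ddag unvecK.
  have -> : odot (ddag (delta_mx j 0)) (delta_mx j 0) = delta_mx j 0 :> 'cV[R]_s.
    apply/colP => i'; rewrite !mxE; case: (i' == j); last by rewrite mulr0.
    by rewrite oner_eq0 invr1 mulr1.
  rewrite -colE => /colP/(_ i); rewrite !mxE.
  have [->|Phi_neq0] := eqVneq (Phi i j) 0; first by rewrite !mulr0.
  by rewrite mulVf // => <-; rewrite mulr1.
exact: (structure_row PhiP).
Qed.

End Structure.

(** * Admissible perturbations *)

Section Admissible.
Variables (R : realType) (n m p s r q : nat).
Variables (S1 : {vspace 'M[R]_n}) (S2 : {vspace 'M[R]_m}).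
Variable S3 : {vspace 'M[R]_p}.
Variables (Phi1 : 'M[R]_(n * n, s)) (Phi2 : 'M[R]_(m * m, r)).
Variable Phi3 : 'M[R]_(p * p, q).
Hypothesis hPhi1 : structure_mx S1 Phi1.
Hypothesis hPhi2 : structure_mx S2 Phi2.
Hypothesis hPhi3 : structure_mx S3 Phi3.

Lemma PhiS_memP (G : dspp R n m p) :
  [/\ blkA G \in S1, blkD G \in S2 & blkE G \in S3] <->
  exists g, vecH G = PhiS Phi1 Phi2 Phi3 *m g.
Proof.
split.
  case=> /(structure_memP hPhi1)[g1 g1E] /(structure_memP hPhi2)[g2 g2E].
  case/(structure_memP hPhi3)=> g3 g3E.
  exists (col_mx g1 (col_mx (col_mx (vec (blkB G)) (vec (blkC G)))
                            (col_mx g2 g3))).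
  by rewrite /PhiS !mul_block_col !mul0mx !mul1mx !addr0 !add0r -g1E -g2E -g3E.
case=> g; rewrite -[g]vsubmxK -[dsubmx g]vsubmxK -[dsubmx (dsubmx g)]vsubmxK.
rewrite /PhiS !mul_block_col !mul0mx !mul1mx !addr0 !add0r.
case/eq_col_mx=> gA /eq_col_mx[_ /eq_col_mx[gD gE]].
by split; [apply/(structure_memP hPhi1)|apply/(structure_memP hPhi2)|
           apply/(structure_memP hPhi3)]; eexists; eassumption.
Qed.

Lemma vecH_surj (v : 'cV[R]_(n * n + ((n * m + m * p) + (m * m + p * p)))) :
  exists G, vecH G = v.
Proof.
exists (Dspp (unvec (usubmx v)) (unvec (usubmx (usubmx (dsubmx v))))
  (unvec (dsubmx (usubmx (dsubmx v)))) (unvec (usubmx (dsubmx (dsubmx v))))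
  (unvec (dsubmx (dsubmx (dsubmx v))))).
by rewrite /vecH /= !unvecK !vsubmxK.
Qed.

Lemma PhiS_indicator : indicator_mx (PhiS Phi1 Phi2 Phi3).
Proof.
apply: indicator_block; first exact: (structure_indicator hPhi1).
apply: indicator_block; first exact: indicator_1.
by apply: indicator_block; [exact: (structure_indicator hPhi2) |
                            exact: (structure_indicator hPhi3)].
Qed.

Lemma DSE : DS Phi1 Phi2 Phi3 = Theta (col_norms (PhiS Phi1 Phi2 Phi3)).
Proof. by rewrite /DS /PhiS !Theta_col_norms_block Theta_col_norms_1. Qed.

Variables (Psi : dspp R n m p) (chi : 'cV[R]_(n + m + p)).
Hypotheses (hPsiA : blkA Psi \in S1) (hPsiD : blkD Psi \in S2)
  (hPsiE : blkE Psi \in S3).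

Let M := block_mx
  (Theta (vecH Psi) *m PhiS Phi1 Phi2 Phi3 *m invmx (DS Phi1 Phi2 Phi3)) 0 0
  (Theta chi).

(* Data and right-hand side are treated at once: the identity is an indicator
   matrix, so unstructured blocks need no separate argument. *)
Let P := block_mx (PhiS Phi1 Phi2 Phi3) 0 0 (1%:M : 'M[R]_(n + m + p)).

Let P_indicator : indicator_mx P.
Proof. exact: indicator_block PhiS_indicator (indicator_1 _ _). Qed.

Lemma weight_mxE :
  M = Theta (col_mx (vecH Psi) chi) *m P *m invmx (Theta (col_norms P)).
Proof.
have := unitmx_col_norms P_indicator.
rewrite /P Theta_col_norms_block Theta_col_norms_1 -DSE => unit_norms.
rewrite invmx_block_diag // Theta_col_mx !mulmx_block invmx1.
by rewrite !(mul0mx, mulmx0, addr0, add0r, mulmx1).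
Qed.

Lemma pert_normE dH db :
  pert_norm Psi chi dH db =
  norm2 (odot (ddag (col_mx (vecH Psi) chi)) (col_mx (vecH dH) db)).
Proof. by rewrite /pert_norm vecH_odot_ddag ddag_col_mx odot_col_mx. Qed.

Lemma weights_gen : exists psi, col_mx (vecH Psi) chi = P *m psi.
Proof.
have [|psi PsiE] := (PhiS_memP Psi).1; first by split.
exists (col_mx psi chi).
by rewrite /P mul_block_col !mul0mx mul1mx addr0 add0r PsiE.
Qed.

Lemma admissibleE dH db :
  admissible S1 S2 S3 Psi chi dH db <->
  (exists g, col_mx (vecH dH) db = P *m g) /\
  forall i, col_mx (vecH Psi) chi i 0 = 0 -> col_mx (vecH dH) db i 0 = 0.
Proof.
split=> [[dA dD dE suppH suppb]|[[g dE] supp]].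
  split.
    have [|g dHE] := (PhiS_memP dH).1; first by split.
    exists (col_mx g db).
    by rewrite /P mul_block_col !mul0mx mul1mx addr0 add0r dHE.
  by move=> i; case: (split_ordP i) => i' ->; rewrite ?col_mxEu ?col_mxEd; auto.
move: dE; rewrite -[g]vsubmxK /P mul_block_col !mul0mx mul1mx addr0 add0r.
case/eq_col_mx=> dHE _.
have [|dA dD dE] := (PhiS_memP dH).2; first by eexists; exact: dHE.
split=> // i.
  by have := supp (lshift _ i); rewrite !col_mxEu.
by have := supp (rshift _ i); rewrite !col_mxEd.
Qed.

(** Together with [admissible_realize], this identifies the admissible
    perturbations with the image under M of a whole Euclidean space, their norm
    being the least length of a preimage. The quotients in the condition number
    thus become those of an operator norm. *)
Lemma admissible_lift dH db : admissible S1 S2 S3 Psi chi dH db ->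
  exists2 v, M *m v = col_mx (vecH dH) db & norm2 v = pert_norm Psi chi dH db.
Proof.
case/admissibleE=> -[g dE]; have [psi PsiE] := weights_gen.
rewrite pert_normE weight_mxE PsiE dE; exact: weighted_lift.
Qed.

Lemma admissible_realize v : exists dH db,
  [/\ admissible S1 S2 S3 Psi chi dH db, col_mx (vecH dH) db = M *m v &
      pert_norm Psi chi dH db <= norm2 v].
Proof.
have [psi PsiE] := weights_gen.
have [] := weighted_proj P_indicator psi v.
rewrite -PsiE -weight_mxE => ex_g supp le_v.
have [dH dHE] := vecH_surj (usubmx (M *m v)).
have MvE : col_mx (vecH dH) (dsubmx (M *m v)) = M *m v by rewrite dHE vsubmxK.
exists dH, (dsubmx (M *m v)); split=> //.
  by apply/admissibleE; rewrite MvE.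
by rewrite pert_normE MvE.
Qed.

End Admissible.

(** * The condition number *)

Lemma lim_at0_linear_bounds (R : realType) (f : R -> \bar R) (l c d : R) : 0 < d ->
  (forall e, 0 < e <= d -> ((l - c * e)%:E <= f e <= (l + c * e)%:E)%E) ->
  lim (f e @[e --> 0^'+]) = l%:E.
Proof.
move=> d_gt0 f_bnd; apply: cvg_lim => //.
have lin_cvg (s : R) : (l + s * e)%:E @[e --> 0^'+] --> l%:E.
  apply: cvg_EFin; first by near=> e.
  rewrite -[X in _ --> X]addr0; apply: cvgD; first exact: cvg_cst.
  rewrite -[X in _ --> X](mulr0 s); apply: cvgMr.
  exact: cvg_at_right_filter cvg_id.
apply: (@squeeze_cvge _ _ _ _ (fun e => (l + (- c) * e)%:E) f
  (fun e => (l + c * e)%:E)); [|exact: lin_cvg..].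
near=> e; rewrite mulNr; apply: f_bnd; apply/andP; split; near: e.
  exact: nbhs_right_gt.
exact: nbhs_right_le.
Unshelve. all: by end_near. Qed.

Local Close Scope classical_set_scope.

Theorem theorem4 (R : realType) (n m p k s r q : nat)
  (S1 : {vspace 'M[R]_n}) (S2 : {vspace 'M[R]_m}) (S3 : {vspace 'M[R]_p})
  (Phi1 : 'M[R]_(n * n, s)) (Phi2 : 'M[R]_(m * m, r)) (Phi3 : 'M[R]_(p * p, q))
  (hPhi1 : structure_mx S1 Phi1) (hPhi2 : structure_mx S2 Phi2)
  (hPhi3 : structure_mx S3 Phi3)
  (H : dspp R n m p) (b : 'cV[R]_(n + m + p))
  (hA : blkA H \in S1) (hD : blkD H \in S2) (hE : blkE H \in S3)
  (hH : saddle_mx H \in unitmx)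
  (x : 'cV[R]_n) (y : 'cV[R]_m) (z : 'cV[R]_p)
  (hw : saddle_mx H *m col_mx (col_mx x y) z = b)
  (L : 'M[R]_(k, n + m + p)) (hk : (k <= n + m + p)%N)
  (xiL : 'cV[R]_k) (chi : 'cV[R]_(n + m + p)) (Psi : dspp R n m p)
  (hPsiA : blkA Psi \in S1) (hPsiD : blkD Psi \in S2) (hPsiE : blkE Psi \in S3) :
  cond_number S1 S2 S3 L xiL Psi chi H b =
  (mxnorm2 (Theta (ddag xiL) *m L *m invmx (saddle_mx H)
    *m row_mx (calG x y z) (- 1%:M)
    *m block_mx
         (Theta (vecH Psi) *m PhiS Phi1 Phi2 Phi3 *m invmx (DS Phi1 Phi2 Phi3))
         0 0 (Theta chi)))%:E.
Proof.
set F := Theta _ *m _ *m _ *m _; set M := block_mx _ _ _ _.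
have lift := @admissible_lift _ _ _ _ _ _ _ _ _ _ _ _ _ hPhi1 hPhi2 hPhi3 _ chi
  hPsiA hPsiD hPsiE.
have realize := admissible_realize hPhi1 hPhi2 hPhi3 chi hPsiA hPsiD hPsiE.
rewrite -/M in lift realize.
have [c [d [c_ge0 d_gt0 first_order]]] :=
  phi_first_order (Theta (ddag xiL) *m L) hH hw.
rewrite -/F /= in first_order.
(* Opaque F and M keep rewriting with associativity from splitting the products
   inside them. *)
clearbody F M.
pose nM := Num.sqrt (sqnormF M).
have nM_ge0 : 0 <= nM by apply: sqrtr_ge0.
pose C := c * nM ^+ 2.
have C_ge0 : 0 <= C by rewrite mulr_ge0 ?sqr_ge0.
pose d' := d / (nM + 1).
have d'_gt0 : 0 < d' by rewrite divr_gt0 // ltr_wpDl.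
(* The second-order remainder, divided by the norm of the perturbation, leaves a
   first-order gap between the two quotients. *)
have ratio_bnd dH db v :
    M *m v = col_mx (vecH dH) db -> norm2 v = pert_norm Psi chi dH db ->
    0 < norm2 v <= d' ->
    `|error_ratio L xiL Psi chi H b dH db - norm2 (F *m M *m v) / norm2 v|
      <= C * norm2 v.
  move=> MvE vE /andP[v_gt0 v_le].
  have Mv_le : norm2 (M *m v) <= nM * norm2 v := norm2_mulmx M v.
  have Mv_d : norm2 (col_mx (vecH dH) db) <= d.
    rewrite -MvE (le_trans Mv_le) //.
    rewrite -[leRHS](divfK (x := nM + 1)) ?gt_eqF ?ltr_wpDl //.
    rewrite mulrC ler_pM ?norm2_ge0 //; lra.
  rewrite /error_ratio -vE -mulrBl normrM normfV (gtr0_norm v_gt0).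
  rewrite ler_pdivrMr // odot_Theta mulmxBr.
  have := first_order dH db Mv_d; rewrite /phi !mulmxA -MvE => fo.
  apply: le_trans (le_trans fo _).
    rewrite -[X in norm2 (_ + X)]opprK -[norm2 (F *m M *m v)]norm2N.
    by rewrite (le_trans (norm2B _ _)) // !mulmxA.
  have -> : C * norm2 v * norm2 v = c * (nM * norm2 v) ^+ 2 by rewrite /C; ring.
  by rewrite ler_wpM2l // lerXn2r ?nnegrE ?norm2_ge0 ?mulr_ge0 ?norm2_ge0.
apply: (@lim_at0_linear_bounds _ _ _ C d') => // e /andP[e_gt0 e_le].
have Ce_ge0 : 0 <= C * e by rewrite mulr_ge0 // ltW.
have nFM_ge0 : 0 <= mxnorm2 (F *m M).
  exact: mxnorm2_ge0.
have sup_ub : (sup_ratio S1 S2 S3 L xiL Psi chi H b e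
    <= (mxnorm2 (F *m M) + C * e)%:E)%E.
  rewrite /sup_ratio ge_max lee_fin addr_ge0 //=.
  apply: ge_ereal_sup => _ [dH [db [adm /andP[pn_gt0 pn_le] ->]]].
  have [v MvE vE] := lift _ _ adm; rewrite -vE in pn_gt0 pn_le.
  have := ratio_bnd dH db v MvE vE; rewrite pn_gt0 (le_trans pn_le) //.
  move=> /(_ isT); rewrite ler_norml => /andP[_].
  have : norm2 (F *m M *m v) / norm2 v <= mxnorm2 (F *m M).
    by rewrite ler_pdivrMr // mxnorm2_ge.
  have := ler_wpM2l C_ge0 pn_le; rewrite lee_fin; lra.
rewrite sup_ub andbT.
(* The perturbation coming from e v has size at most e. Lifting it to u of length
   equal to its size can only increase the quotient, as F M u = F M (e v) and
   |u| <= e. If u = 0 then F M v = 0, and the bound is trivial. *)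
have sup_lb v : norm2 v <= 1 -> ((norm2 (F *m M *m v) - C * e)%:E
    <= sup_ratio S1 S2 S3 L xiL Psi chi H b e)%E.
  move=> v_le1; rewrite /sup_ratio le_max.
  have [dH [db [adm dE pn_le]]] := realize (e *: v).
  have {}pn_le : pert_norm Psi chi dH db <= e.
    by rewrite (le_trans pn_le) // norm2Z gtr0_norm // ler_piMr // ltW.
  have [u MuE uE] := lift _ _ adm.
  have FMu : norm2 (F *m M *m u) = e * norm2 (F *m M *m v).
    by rewrite -!mulmxA MuE dE -!scalemxAr norm2Z gtr0_norm.
  have [u0|u_neq0] := eqVneq (norm2 u) 0.
    apply/orP; left; rewrite lee_fin.
    move: FMu; rewrite (norm2_eq0 u0) mulmx0 norm2_0 => /esym/eqP.
    rewrite mulf_eq0 gt_eqF //= => /eqP ->; lra.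
  have u_gt0 : 0 < norm2 u by rewrite lt_def u_neq0 norm2_ge0.
  apply/orP; right.
  apply: le_trans (ereal_sup_ubound _); last first.
    by exists dH, db; split=> //; rewrite -uE u_gt0 uE.
  have u_le : norm2 u <= e by rewrite uE.
  have := ratio_bnd dH db u MuE uE; rewrite u_gt0 (le_trans u_le) //.
  move=> /(_ isT); rewrite ler_norml => /andP[+ _].
  have : norm2 (F *m M *m v) <= norm2 (F *m M *m u) / norm2 u.
    by rewrite ler_pdivlMr // FMu mulrC ler_wpM2r ?norm2_ge0.
  have := ler_wpM2l C_ge0 u_le; rewrite lee_fin; lra.
case: (sup_ratio _ _ _ _ _ _ _ _ _ _) sup_ub sup_lb => [a _ sup_lb|//|_].
  rewrite lee_fin lerBlDr; apply: mxnorm2_le => v /sup_lb.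
  by rewrite lee_fin lerBlDr.
by move=> /(_ 0); rewrite norm2_0 ler01 => /(_ isT).
Qed.
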